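(* Let $\alpha=(\alpha_1,\ldots,\alpha_n)$ be a composition such that $\alpha_i=\alpha_{i+1}$ for some $i\in\{1,\ldots,n-1\}$, and let $\sigma\in S_n$. Then $$E_{\alpha}^{\sigma}(x_1,\ldots,x_n;q,t)=E_{\alpha}^{\sigma s_i}(x_1,\ldots,x_n;q,t).$$
   Context: Permutations $\sigma\in S_n$ are written in one-line notation $\sigma=[\sigma_1,\ldots,\sigma_n]$, with product $(\sigma\pi)_j=\sigma_{\pi_j}$. $s_i$ is the simple transposition exchanging $i$ and $i+1$, so $\sigma s_i=[\sigma_1,\ldots,\sigma_{i-1},\sigma_{i+1},\sigma_i,\sigma_{i+2},\ldots,\sigma_n]$. Let $w_0=[n,n-1,\ldots,1]$ and $\mathrm{rev}(\sigma)=\sigma w_0=[\sigma_n,\ldots,\sigma_1]$. A composition of length $n$ is a sequence $\alpha=(\alpha_1,\ldots,\alpha_n)$ of nonnegative integers; $\mathrm{rev}(\alpha)=(\alpha_n,\ldots,\alpha_1)$, and $x^\alpha=\prod x_j^{\alpha_j}$. A permutation acts on polynomials in $\mathbb{Q}(q,t)[x_1,\ldots,x_n]$ by permuting variables, so $s_i$ swaps $x_i$ and $x_{i+1}$. The Demazure–Lusztig operators are $T_i(f)=t\,s_i(f)+(1-t)x_{i+1}\frac{f-s_i(f)}{x_i-x_{i+1}}$ for $i\in\{1,\ldots,n-1\}$; for a reduced expression $\sigma=s_{i_1}\cdots s_{i_k}$, $T_\sigma=T_{i_1}\circ\cdots\circ T_{i_k}$. Let $g(f)(x_1,\ldots,x_n)=f(x_2,\ldots,x_n,q^{-1}x_1)$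 and $Y_j=t^{j-1}T_{j-1}^{-1}\cdots T_1^{-1}\,g\,T_{n-1}\cdots T_j$. For a composition $\alpha$, the nonsymmetric Macdonald polynomial $E_\alpha$ is the unique element of $\mathbb{Q}(q,t)[x_1,\ldots,x_n]$ in which the coefficient of $x^\alpha$ is $1$ and $Y_jE_\alpha=q^{-\alpha_j}t^{k_j}E_\alpha$ for all $j$, where $k_j=|\{m<j:\alpha_m>\alpha_j\}|+|\{m>j:\alpha_m\ge\alpha_j\}|$. For $\sigma\in S_n$, the permuted-basement Macdonald polynomial is $E_\alpha^\sigma=t^{-\mathrm{twinv}(\alpha,\sigma)}T_{\mathrm{rev}(\sigma)}E_{\mathrm{rev}(\alpha)}$, where $\mathrm{twinv}(\alpha,\sigma)=|\{(j,m):j<m,\ \alpha_j\ge\alpha_m,\ \sigma_j<\sigma_m\}|$. *)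

(* Defs.v *)
From HB Require Import structures.
From mathcomp Require Import all_boot all_order all_algebra all_fingroup.
From mathcomp Require Import fraction.
From mathcomp Require Import mpoly.
From Stdlib Require Import ClassicalEpsilon.

Set Implicit Arguments.
Unset Strict Implicit.
Unset Printing Implicit Defensive.

Import GRing.Theory.
Local Open Scope ring_scope.

Definition the_or (T : Type) (d : T) (P : T -> Prop) : T :=
  match excluded_middle_informative (exists x, P x) with
  | left h => proj1_sig (constructive_indefinite_description P h)
  | right _ => d
  end.

Definition Kqt : Type := {fraction {poly {poly rat}}}.
Definition qq : Kqt := tofrac ('X%:P : {poly {poly rat}}).
Definition tt : Kqt := tofrac ('X : {poly {poly rat}}).

(* Polynomials in x_1..x_n over Q(q,t).  Variables are 0-indexed:      *)
(* paper's x_j is 'X_(j-1).                                             *)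
Notation Pol n := {mpoly Kqt[n]}.

(* variable with a nat index (0 if out of range; never used so)         *)
Definition xv (n : nat) (k : nat) : Pol n :=
  if insub k is Some j then 'X_j else 0.

Definition subst (n : nat) (phi : 'I_n -> Pol n) (f : Pol n) : Pol n :=
  f \mPo [tuple phi j | j < n].

(* simple transposition s_k (0-based: swaps positions k and k+1, i.e.  *)
(* the paper's s_{k+1}); the identity if k+1 >= n.                      *)
Definition stp (n : nat) (k : nat) : 'S_n :=
  match insub k, insub k.+1 with
  | Some a, Some b => tperm a b
  | _, _ => 1%g
  end.

Definition sact (n : nat) (k : nat) (f : Pol n) : Pol n :=
  subst (fun j => 'X_(stp n k j)) f.

Definition ddiff (n : nat) (k : nat) (f : Pol n) : Pol n :=
  the_or 0 (fun h => (xv n k - xv n k.+1) * h = f - sact k f).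

(* Demazure--Lusztig operator T_k (0-based index; paper's T_{k+1}) *)
Definition DL (n : nat) (k : nat) (f : Pol n) : Pol n :=
  tt *: sact k f + (1 - tt) *: (xv n k.+1 * ddiff k f).

Definition DLinv (n : nat) (k : nat) (f : Pol n) : Pol n :=
  the_or 0 (fun h => DL k h = f).

Definition gop (n : nat) (f : Pol n) : Pol n :=
  subst (fun j : 'I_n => if ((val j).+1 < n)%N then xv n (val j).+1
                         else qq^-1 *: xv n 0) f.

(* Y_j (0-based j; paper's Y_{j+1}):
   Y = t^j T_{j-1}^{-1} ... T_0^{-1} g T_{n-2} ... T_j   (0-based T's) *)
Definition Yop (n : nat) (j : nat) (f : Pol n) : Pol n :=
  tt ^+ j *: foldl (fun acc k => DLinv k acc)
                 (gop (foldl (fun acc k => DL k acc) f (iota j (n.-1 - j))))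
                 (iota 0 j).

(* compositions of length n are exponent vectors 'X_{1..n} *)
Definition kexp (n : nat) (a : 'X_{1..n}) (j : 'I_n) : nat :=
  #|[set m : 'I_n | (m < j)%N && (a j < a m)%N]|
  + #|[set m : 'I_n | (j < m)%N && (a j <= a m)%N]|.

Definition is_nsMac (n : nat) (a : 'X_{1..n}) (f : Pol n) : Prop :=
  f@_a = 1 /\
  forall j : 'I_n, Yop (val j) f = ((qq ^+ a j)^-1 * tt ^+ kexp a j) *: f.

Definition nsMac (n : nat) (a : 'X_{1..n}) : Pol n := the_or 0 (is_nsMac a).

(* paper's product: (sigma pi)_j = sigma_{pi_j}, i.e. composition
   sigma \o pi, which is (pi * sigma)%g in mathcomp. *)
Definition pmul (n : nat) (s p : 'S_n) : 'S_n := (p * s)%g.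

Fixpoint word_perm (n : nat) (w : seq nat) : 'S_n :=
  match w with
  | [::] => 1%g
  | k :: w' => pmul (stp n k) (word_perm n w')
  end.

Definition reduced_word (n : nat) (w : seq nat) (s : 'S_n) : Prop :=
  [/\ all (fun k => k.+1 < n)%N w, word_perm n w = s &
      forall w' : seq nat, word_perm n w' = s -> (size w <= size w')%N].

Definition DLword (n : nat) (w : seq nat) (f : Pol n) : Pol n :=
  foldr (fun k acc => DL k acc) f w.

Definition DLperm (n : nat) (s : 'S_n) (f : Pol n) : Pol n :=
  DLword (the_or [::] (fun w => reduced_word w s)) f.

Definition w0 (n : nat) : 'S_n := perm (@rev_ord_inj n).
Definition revp (n : nat) (s : 'S_n) : 'S_n := pmul s (w0 n).
Definition revc (n : nat) (a : 'X_{1..n}) : 'X_{1..n} :=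
  [multinom a (rev_ord i) | i < n].

Definition twinv (n : nat) (a : 'X_{1..n}) (s : 'S_n) : nat :=
  #|[set jm : 'I_n * 'I_n |
      [&& (jm.1 < jm.2)%N, (a jm.2 <= a jm.1)%N & (s jm.1 < s jm.2)%N]]|.

Definition nsMacPB (n : nat) (a : 'X_{1..n}) (s : 'S_n) : Pol n :=
  (tt ^+ twinv a s)^-1 *: DLperm (revp s) (nsMac (revc a)).

(* Main.v *)
Require Import Defs.
From HB Require Import structures.
From mathcomp Require Import all_boot all_order all_algebra all_fingroup.
From mathcomp Require Import fraction generic_quotient ring zify.
From mathcomp Require Import mpoly.
From Stdlib Require Import ClassicalEpsilon.

Set Implicit Arguments.
Unset Strict Implicit.
Unset Printing Implicit Defensive.

Import GRing.Theory.
Local Open Scope ring_scope.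

(* Put beta = rev(alpha) and let k be the position with beta_k = beta_(k+1).
   Since rev(sigma s_i) = rev(sigma) s_k, and since T_sigma does not depend on
   the reduced word (the T_j satisfy the braid relations), the theorem reduces
   to T_k E_beta = t E_beta, the factor t being absorbed by twinv.

   Let h = (T_k - t) E_beta.  The quadratic relation gives T_k h = - h, and
   Y_(k+1) = t T_k^-1 Y_k T_k^-1 gives Y_k h = q^(-beta_k) t^c h for some c.
   Suppose h <> 0 and rescale it to be regular and nonzero at t = 1.  There T_k
   specializes to s_k and Y_k to the substitution x_k := x_k / q, so every
   monomial of the specialization has x_k-exponent beta_k; being antisymmetric
   in x_k and x_(k+1), the specialization has x_(k+1)-exponent beta_k as well,
   hence is also symmetric, hence vanishes: a contradiction.  No triangularity
   of the Y_j is needed.  If no E_beta existed, nsMac would be the junk value 0,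
   for which the identity is trivial. *)

Lemma the_orP (T : Type) (d : T) (P : T -> Prop) :
  (exists x, P x) -> P (the_or d P).
Proof.
rewrite /the_or; case: excluded_middle_informative => // h _.
exact: proj2_sig.
Qed.

Lemma the_or_uniq (T : Type) (d : T) (P : T -> Prop) (x : T) :
  P x -> (forall y, P y -> y = x) -> the_or d P = x.
Proof. by move=> Px uniqP; apply: uniqP; apply: the_orP; exists x. Qed.

Lemma tofrac_inj (R : idomainType) : injective (@tofrac R).
Proof. by move=> x y /eqP; rewrite tofrac_eq => /eqP. Qed.

(** * Hecke relations *)

Section DemazureLusztigFormula.

Variables (F : fieldType) (t : F).

(** T_i as a rational expression in f and s f, kept as independent field elements so that every
    Hecke relation becomes an identity for [field]. *)
Definition dl (x y f sf : F) := ((t * x - y) * sf + (1 - t) * y * f) / (x - y).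

Lemma dl_quadratic x y f f1 : x - y != 0 ->
  dl x y (dl x y f f1) (dl y x f1 f) = (t - 1) * dl x y f f1 + t * f.
Proof.
move=> nxy; have nyx : y - x != 0 by rewrite -opprB oppr_eq0.
by rewrite /dl; field; rewrite nxy nyx.
Qed.

Lemma dl_commute x y z w f f1 f2 f12 : x - y != 0 -> z - w != 0 ->
  dl x y (dl z w f f2) (dl z w f1 f12) = dl z w (dl x y f f1) (dl x y f2 f12).
Proof. by move=> nxy nzw; rewrite /dl; field; rewrite nxy nzw. Qed.

(** The six values are the images of f under S_3, [f12] standing for s_1 s_2 f and so on; an inner
    term such as [dl x z f2 f21] is the image under s_2 of T_1 f. *)
Lemma dl_braid x y z f f1 f2 f12 f21 f121 :
    x - y != 0 -> y - z != 0 -> x - z != 0 ->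
  dl x y (dl y z (dl x y f f1) (dl x z f2 f21))
         (dl x z (dl y x f1 f) (dl y z f12 f121))
  = dl y z (dl x y (dl y z f f2) (dl x z f1 f12))
           (dl x z (dl z y f2 f) (dl x y f21 f121)).
Proof.
move=> nxy nyz nxz; rewrite /dl.
have nyx : y - x != 0 by rewrite -opprB oppr_eq0.
have nzy : z - y != 0 by rewrite -opprB oppr_eq0.
by field; rewrite nxy nyz nxz nyx nzy.
Qed.

End DemazureLusztigFormula.

Section AbstractHecke.

Variables (R : idomainType) (t : R).

(* [T] is the operator [t s + (1 - t) y (1 - s) / (x - y)], with the
   denominator cleared. *)
Definition is_DL (s : R -> R) (x y : R) (T : R -> R) :=
  forall f, (x - y) * T f = (t * x - y) * s f + (1 - t) * y * f.

Local Notation emb := (@tofrac R).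

Lemma tofracB_neq0 (x y : R) : x != y -> emb x - emb y != 0.
Proof. by rewrite subr_eq0 tofrac_eq. Qed.

(** Apply [r] to the relation [is_DL] and divide by r x - r y. The morphism [r] is there because an
    outer operator also involves the image under s of the inner T f. *)
Lemma tofrac_DL s x y T (r : {rmorphism R -> R}) f :
    is_DL s x y T -> r t = t -> r x != r y ->
  emb (r (T f)) =
    dl (emb t) (emb (r x)) (emb (r y)) (emb (r f)) (emb (r (s f))).
Proof.
move=> hT rt nxy; rewrite /dl; have /(congr1 r) := hT f.
rewrite !(rmorphM, rmorphB, rmorphD, rmorph1) /= rt => /(congr1 emb).
rewrite tofracD !tofracM !tofracB tofracM tofrac1 => <-.
by rewrite [_ / _]mulrC mulKf // tofracB_neq0.
Qed.

Lemma is_DL_add (s : {rmorphism R -> R}) x y T f g :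
  is_DL s x y T -> x != y -> T (f + g) = T f + T g.
Proof.
rewrite -subr_eq0 => hT nxy; apply: (mulfI nxy).
by rewrite [RHS]mulrDr !hT rmorphD; ring.
Qed.

Lemma is_DL_mul (s : {rmorphism R -> R}) x y T c f :
  is_DL s x y T -> x != y -> s c = c -> T (c * f) = c * T f.
Proof.
rewrite -subr_eq0 => hT nxy sc; apply: (mulfI nxy).
by rewrite [RHS]mulrCA !hT rmorphM sc; ring.
Qed.

Lemma DL_quadratic (s : {rmorphism R -> R}) x y T f :
    is_DL s x y T -> s t = t -> s x = y -> s y = x -> s (s f) = f -> x != y ->
  T (T f) = (t - 1) * T f + t * f.
Proof.
move=> hT st sx sy ss nxy.
have syx : s x != s y by rewrite sx sy eq_sym.
have E1 g : emb (T g) =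
    dl (emb t) (emb x) (emb y) (emb g) (emb (s g)) :=
  tofrac_DL (r := idfun) g hT erefl nxy.
have E2 := tofrac_DL (r := s) f hT st syx.
apply: (tofrac_inj (R := R)).
rewrite tofracD !tofracM tofracB tofrac1 E1 E2 sx sy ss E1.
by apply: dl_quadratic; apply: tofracB_neq0.
Qed.

Lemma DL_commute (s1 s2 : {rmorphism R -> R}) x y z w T1 T2 f :
    is_DL s1 x y T1 -> is_DL s2 z w T2 -> s1 t = t -> s2 t = t ->
    s1 z = z -> s1 w = w -> s2 x = x -> s2 y = y ->
    s1 (s2 f) = s2 (s1 f) -> x != y -> z != w ->
  T1 (T2 f) = T2 (T1 f).
Proof.
move=> h1 h2 t1 t2 s1z s1w s2x s2y s12 nxy nzw.
have s1zw : s1 z != s1 w by rewrite s1z s1w.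
have s2xy : s2 x != s2 y by rewrite s2x s2y.
have E1 g : emb (T1 g) =
    dl (emb t) (emb x) (emb y) (emb g) (emb (s1 g)) :=
  tofrac_DL (r := idfun) g h1 erefl nxy.
have E2 g : emb (T2 g) =
    dl (emb t) (emb z) (emb w) (emb g) (emb (s2 g)) :=
  tofrac_DL (r := idfun) g h2 erefl nzw.
have E12 := tofrac_DL (r := s1) f h2 t1 s1zw.
have E21 := tofrac_DL (r := s2) f h1 t2 s2xy.
apply: (tofrac_inj (R := R)).
rewrite (E1 (T2 f)) E12 (E2 (T1 f)) E21 (E1 f) (E2 f) s1z s1w s2x s2y s12.
by apply: dl_commute; apply: tofracB_neq0.
Qed.

Lemma DL_braid (s1 s2 : {rmorphism R -> R}) x y z T1 T2 f :
    is_DL s1 x y T1 -> is_DL s2 y z T2 -> s1 t = t -> s2 t = t ->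
    s1 x = y -> s1 y = x -> s1 z = z -> s2 x = x -> s2 y = z -> s2 z = y ->
    s1 (s1 f) = f -> s2 (s2 f) = f ->
    s1 (s2 (s1 f)) = s2 (s1 (s2 f)) -> x != y -> y != z -> x != z ->
  T1 (T2 (T1 f)) = T2 (T1 (T2 f)).
Proof.
move=> h1 h2 t1 t2 s1x s1y s1z s2x s2y s2z s11 s22 s121 nxy nyz nxz.
have n11 : s1 x != s1 y by rewrite s1x s1y eq_sym.
have n12 : s1 y != s1 z by rewrite s1y s1z.
have n21 : s2 x != s2 y by rewrite s2x s2y.
have n22 : s2 y != s2 z by rewrite s2y s2z eq_sym.
have t12 : s1 (s2 t) = t by rewrite t2 t1.
have t21 : s2 (s1 t) = t by rewrite t1 t2.
have n121 : s1 (s2 x) != s1 (s2 y) by rewrite s2x s2y s1x s1z.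
have n212 : s2 (s1 y) != s2 (s1 z) by rewrite s1y s1z s2x s2z.
have E1 g : emb (T1 g) =
    dl (emb t) (emb x) (emb y) (emb g) (emb (s1 g)) :=
  tofrac_DL (r := idfun) g h1 erefl nxy.
have E2 g : emb (T2 g) =
    dl (emb t) (emb y) (emb z) (emb g) (emb (s2 g)) :=
  tofrac_DL (r := idfun) g h2 erefl nyz.
have E11 := tofrac_DL (r := s1) f h1 t1 n11.
have E12 g := tofrac_DL (r := s1) g h2 t1 n12.
have E21 g := tofrac_DL (r := s2) g h1 t2 n21.
have E22 := tofrac_DL (r := s2) f h2 t2 n22.
have E121 : emb (s1 (s2 (T1 f))) = _ :=
  tofrac_DL (r := s1 \o s2) f h1 t12 n121.
have E212 : emb (s2 (s1 (T2 f))) = _ :=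
  tofrac_DL (r := s2 \o s1) f h2 t21 n212.
rewrite /= in E121 E212.
apply: (tofrac_inj (R := R)).
rewrite (E1 (T2 (T1 f))) (E2 (T1 f)) (E1 f) (E21 f) (E12 (T1 f)) E11 E121.
rewrite (E2 (T1 (T2 f))) (E1 (T2 f)) (E2 f) (E12 f) (E21 (T2 f)) E22 E212.
rewrite !(s1x, s1y, s1z, s2x, s2y, s2z) s11 s22 s121.
by apply: dl_braid; apply: tofracB_neq0.
Qed.

End AbstractHecke.

(** * Regularity at t = 1 *)

Section RegularAtOne.

Local Notation A := {poly {poly rat}}.

(* [c] has no pole at [t = 1]. *)
Definition reg1 (c : Kqt) :=
  exists a b : A, b.[1] != 0 /\ c * tofrac b = tofrac a.

Lemma reg1_tofrac (a : A) : reg1 (tofrac a).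
Proof. by exists a, 1; rewrite hornerC oner_eq0 tofrac1 mulr1. Qed.

Lemma reg1V_tofrac (a : A) : a.[1] != 0 -> reg1 (tofrac a)^-1.
Proof.
move=> a1; exists 1, a; split=> //; rewrite tofrac1 mulVf //.
by rewrite tofrac_eq0; apply: contraNneq a1 => ->; rewrite horner0.
Qed.

Lemma reg1D c d : reg1 c -> reg1 d -> reg1 (c + d).
Proof.
move=> [a [b [nb e]]] [a' [b' [nb' e']]]; exists (a * b' + a' * b), (b * b').
rewrite hornerM mulf_neq0 //; split=> //.
rewrite tofracD !tofracM -e -e' mulrDl; congr (_ + _); first by rewrite mulrA.
by rewrite (mulrC (tofrac b)) mulrA.
Qed.

Lemma reg1M c d : reg1 c -> reg1 d -> reg1 (c * d).
Proof.
move=> [a [b [nb e]]] [a' [b' [nb' e']]]; exists (a * a'), (b * b').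
by rewrite hornerM mulf_neq0 //; split=> //; rewrite !tofracM -e -e' mulrACA.
Qed.

Lemma reg1_0 : reg1 0. Proof. by rewrite -[0]tofrac0; apply: reg1_tofrac. Qed.
Lemma reg1_1 : reg1 1. Proof. by rewrite -[1]tofrac1; apply: reg1_tofrac. Qed.

Lemma reg1N c : reg1 c -> reg1 (- c).
Proof.
move=> rc; rewrite -mulN1r; apply: reg1M => //.
by have := reg1_tofrac (- 1); rewrite tofracN tofrac1.
Qed.

Lemma reg1B c d : reg1 c -> reg1 d -> reg1 (c - d).
Proof. by move=> rc rd; apply/reg1D/reg1N. Qed.

Lemma reg1X c k : reg1 c -> reg1 (c ^+ k).
Proof.
move=> rc; elim: k => [|k ihk]; first by rewrite expr0; apply: reg1_1.
by rewrite exprS; apply: reg1M.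
Qed.

Lemma reg1_sum (I : Type) (r : seq I) (P : pred I) (F : I -> Kqt) :
  (forall i, P i -> reg1 (F i)) -> reg1 (\sum_(i <- r | P i) F i).
Proof. by move=> rF; apply: big_ind => //; [apply: reg1_0 | apply: reg1D]. Qed.

Lemma reg1_tt : reg1 tt. Proof. exact: reg1_tofrac. Qed.
Lemma reg1_qq : reg1 qq. Proof. exact: reg1_tofrac. Qed.

Lemma reg1V_tt : reg1 tt^-1.
Proof. by apply: reg1V_tofrac; rewrite hornerX oner_eq0. Qed.

Lemma reg1V_qq : reg1 qq^-1.
Proof. by apply: reg1V_tofrac; rewrite hornerC polyX_eq0. Qed.

Lemma tt_neq0 : tt != 0.
Proof. by rewrite tofrac_eq0 polyX_eq0. Qed.

Lemma qq_neq0 : qq != 0.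
Proof. by rewrite tofrac_eq0 polyC_eq0 polyX_eq0. Qed.

Lemma one_sub_tt_neq0 : 1 - tt != 0.
Proof.
rewrite -[1]tofrac1 -tofracB tofrac_eq0.
apply/eqP => /(congr1 (fun p : A => p.[0])).
by rewrite !hornerE subr0 => /eqP; rewrite oner_eq0.
Qed.

(** The inverse equals q^i q^j / (q^j - q^i), whose denominator is nonzero and constant in t, hence
    nonzero at t = 1. *)
Lemma reg1V_qqXB (i j : nat) : i != j -> reg1 (qq ^- i - qq ^- j)^-1.
Proof.
move=> nij; have nz k : qq ^+ k != 0 by rewrite expf_neq0 // qq_neq0.
have -> : qq ^- i - qq ^- j = (qq ^+ j - qq ^+ i) / (qq ^+ i * qq ^+ j).
  by rewrite invfM mulrBl mulrCA divff // mulr1 mulVKf.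
rewrite invf_div; apply: reg1M; first by apply: reg1M; apply/reg1X/reg1_qq.
rewrite /qq -!tofracXn -tofracB; apply: reg1V_tofrac.
rewrite -!polyC_exp -polyCB hornerC subr_eq0.
apply: contra nij => /eqP /(congr1 (fun p : {poly rat} => size p)).
by rewrite !size_polyXn => -[->].
Qed.

Lemma natS_poly_neq0 (k : nat) : k.+1%:R != 0 :> {poly rat}.
Proof. by rewrite -polyC_natr polyC_eq0 Num.Theory.pnatr_eq0. Qed.

Lemma natS_neq0 (k : nat) : k.+1%:R != 0 :> Kqt.
Proof.
have -> : k.+1%:R = tofrac k.+1%:R :> Kqt by rewrite rmorph_nat.
by rewrite tofrac_eq0 -polyC_natr polyC_eq0 natS_poly_neq0.
Qed.

Lemma reg1V_nat (k : nat) : reg1 k.+1%:R^-1.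
Proof.
have -> : k.+1%:R = tofrac k.+1%:R :> Kqt by rewrite rmorph_nat.
by apply: reg1V_tofrac; rewrite -polyC_natr hornerC natS_poly_neq0.
Qed.

Lemma fraction_ratio (R : idomainType) (c : {fraction R}) :
  exists a b : R, b != 0 /\ c * tofrac b = tofrac a.
Proof.
elim/quotW: c => x; exists (frac x).1, (frac x).2.
have nd : (frac x).2 != 0 by apply: denom_ratioP.
split=> //; unlock tofrac; rewrite -[LHS]FracField.pi_mul.
apply/eqmodP; rewrite /= FracField.equivfE /FracField.mulf.
by rewrite !numden_Ratio ?(oner_neq0, mul1r, mulr1) // mulrC.
Qed.

(** Up to factors invertible at t = 1, a numerator of c would be divisible by every power of 1 - t,
    whereas a nonzero polynomial vanishes at t = 1 to an order below its size. *)
Lemma reg1_divisible_eq0 (c : Kqt) :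
  (forall k, reg1 (c / (1 - tt) ^+ k)) -> c = 0.
Proof.
move=> rc; have [a [b [nb e]]] := fraction_ratio c.
(* Induction on k: for k > 0 the right-hand side vanishes at t = 1 and v does not, so a factor t - 1
   splits off the polynomial. *)
have div k (u v : A) : forall a : A, v.[1] != 0 ->
    a * v = (1 - 'X) ^+ k * u -> (k < size a)%N || (a == 0).
  elim: k => [|k ihk] a0 nv; first by rewrite lt0n size_poly_eq0 orNb.
  rewrite exprS => ea; have := congr1 (horner^~ 1) ea.
  have z1 : (1 - 'X : A).[1] = 0 by rewrite !hornerE subrr.
  rewrite -mulrA hornerM [RHS]hornerM z1 mul0r => /eqP.
  rewrite mulf_eq0 (negbTE nv) orbF => /factor_theorem [d ed].
  have {ea}: (- d) * v = (1 - 'X) ^+ k * u.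
    have nz : 1 - 'X != 0 :> A.
      by rewrite -opprB oppr_eq0 -polyC1 polyXsubC_eq0.
    apply: (mulfI nz); rewrite [RHS]mulrA -ea ed polyC1; ring.
  move=> /(ihk _ nv); rewrite size_polyN oppr_eq0 ed.
  case: (d =P 0) => [->|/eqP nd]; first by rewrite mul0r eqxx !orbT.
  by rewrite size_Mmonic ?monicXsubC // size_XsubC addn2 /= ltnS orbF => ->.
(* The exponent [size a] excludes the alternative k < [size a] and leaves a = 0. *)
have [a' [b' [nb' e']]] := rc (size a).
have := div (size a) (a' * b) b' a nb'.
case/(_ _)/orP.
- apply: (@tofrac_inj A); rewrite !tofracM tofracXn tofracB tofrac1 -e -e'.
  have nz : (1 - tt) ^+ size a != 0 by rewrite expf_neq0 // one_sub_tt_neq0.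
  have -> : (1 : Kqt) - tofrac 'X = 1 - tt by [].
  by rewrite [RHS]mulrA [in RHS]mulrA (mulrC (_ ^+ _)) divfK // mulrAC.
- by rewrite ltnn.
move=> /eqP a0; have nfb : tofrac b != 0 by rewrite tofrac_eq0.
by apply: (mulIf nfb); rewrite e a0 tofrac0 mul0r.
Qed.

End RegularAtOne.

(** * Polynomials whose coefficients are regular at t = 1 *)

Section RegularPolynomials.

Variable n : nat.
Implicit Types (f g : Pol n).

Definition preg1 f := forall m, reg1 f@_m.

Lemma preg1D f g : preg1 f -> preg1 g -> preg1 (f + g).
Proof. by move=> rf rg m; rewrite mcoeffD; apply: reg1D. Qed.

Lemma preg1Z c f : reg1 c -> preg1 f -> preg1 (c *: f).
Proof. by move=> rc rf m; rewrite mcoeffZ; apply: reg1M. Qed.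

Lemma preg1N f : preg1 f -> preg1 (- f).
Proof. by move=> rf m; rewrite mcoeffN; apply: reg1N. Qed.

Lemma preg1B f g : preg1 f -> preg1 g -> preg1 (f - g).
Proof. by move=> rf rg; apply/preg1D/preg1N. Qed.

Lemma preg1M f g : preg1 f -> preg1 g -> preg1 (f * g).
Proof.
by move=> rf rg m; rewrite mcoeffM; apply: reg1_sum => k _; apply: reg1M.
Qed.

Lemma preg1_monomial m : preg1 'X_[m].
Proof.
by move=> k; rewrite mcoeffX; case: eqP => _; [apply: reg1_1 | apply: reg1_0].
Qed.

Lemma preg1_0 : preg1 0.
Proof. by move=> m; rewrite mcoeff0; apply: reg1_0. Qed.

Lemma preg1_1 : preg1 1.
Proof. by rewrite -mpolyX0; apply: preg1_monomial. Qed.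

Lemma preg1_prod (I : Type) (r : seq I) (P : pred I) (F : I -> Pol n) :
  (forall i, P i -> preg1 (F i)) -> preg1 (\prod_(i <- r | P i) F i).
Proof.
by move=> rF; apply: big_ind => //; [apply: preg1_1 | apply: preg1M].
Qed.

Lemma preg1X f k : preg1 f -> preg1 (f ^+ k).
Proof.
move=> rf; elim: k => [|k ihk]; first by rewrite expr0; apply: preg1_1.
by rewrite exprS; apply: preg1M.
Qed.

Lemma preg1_subst phi f :
  (forall i, preg1 (phi i)) -> preg1 f -> preg1 (subst phi f).
Proof.
move=> rphi rf; rewrite /subst comp_mpolyE.
apply: big_ind => [||m _]; [exact: preg1_0 | exact: preg1D |].
apply: preg1Z => //; apply: preg1_prod => i _.
by rewrite tnth_mktuple; apply: preg1X.
Qed.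

(** A common denominator, collected term by term, removes all poles; this normalizes an arbitrary
    polynomial before the descent at t = 1. *)
Lemma preg1_scale f : exists2 c, c != 0 & preg1 (c *: f).
Proof.
suff [d nd rd] : exists2 d : {poly {poly rat}}, d != 0 & preg1 (tofrac d *: f).
  by exists (tofrac d); rewrite ?tofrac_eq0.
elim/mpolyind: f => [|c m p _ _ [d nd rd]].
  by exists 1; rewrite ?oner_eq0 // scaler0; apply: preg1_0.
have [a [b [nb e]]] := fraction_ratio c.
exists (d * b); first by rewrite mulf_neq0.
rewrite tofracM scalerDr; apply: preg1D.
  rewrite scalerA -mulrA (mulrC _ c) e -tofracM.
  by apply: preg1Z; [apply: reg1_tofrac | apply: preg1_monomial].
by rewrite mulrC -scalerA; apply: preg1Z => //; apply: reg1_tofrac.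
Qed.

End RegularPolynomials.

(** * Demazure--Lusztig operators on polynomials *)

Section SimpleTranspositions.

Variables (n k : nat).
Hypothesis hk : (k.+1 < n)%N.

Definition olo : 'I_n := Ordinal (ltnW hk).
Definition ohi : 'I_n := Ordinal hk.

Lemma olo_neq_ohi : olo != ohi.
Proof. by rewrite -val_eqE /= ltn_eqF. Qed.

Lemma stpE : stp n k = tperm olo ohi.
Proof.
rewrite /stp (insubT (fun i => i < n)%N (ltnW hk)).
by rewrite (insubT (fun i => i < n)%N hk).
Qed.

Lemma stp_lo : stp n k olo = ohi. Proof. by rewrite stpE tpermL. Qed.
Lemma stp_hi : stp n k ohi = olo. Proof. by rewrite stpE tpermR. Qed.

Lemma stp_out (j : 'I_n) : val j != k -> val j != k.+1 -> stp n k j = j.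
Proof. by move=> h1 h2; rewrite stpE tpermD // -val_eqE eq_sym. Qed.

Lemma stp2 : (stp n k * stp n k = 1)%g.
Proof. by rewrite stpE tperm2. Qed.

Lemma xv_lo : xv n k = 'X_olo.
Proof. by rewrite /xv (insubT (fun i => i < n)%N (ltnW hk)). Qed.

Lemma xv_hi : xv n k.+1 = 'X_ohi.
Proof. by rewrite /xv (insubT (fun i => i < n)%N hk). Qed.

End SimpleTranspositions.

Lemma mpolyX_inj n : injective (fun i : 'I_n => 'X_i : Pol n).
Proof.
move=> i j /(congr1 (mcoeff U_(i)%MM)); rewrite !mcoeffXU eqxx.
by case: eqP => // _ /eqP; rewrite oner_eq0.
Qed.

Lemma mpolyX_neq n (i j : 'I_n) : i != j -> ('X_i : Pol n) != 'X_j.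
Proof. by apply: contra => /eqP/mpolyX_inj ->. Qed.

Lemma sactE n k (f : Pol n) : sact k f = msym (stp n k) f.
Proof.
rewrite /sact /subst /comp_mpoly /msym; apply: eq_bigr => m _.
by congr (_ * _); apply: mmap1_eq => i; rewrite tnth_mktuple.
Qed.

Lemma msym_X n (s : 'S_n) (i : 'I_n) : msym s ('X_i : Pol n) = 'X_(s i).
Proof. by rewrite /msym mmapX mmap1U. Qed.

Lemma msymC n (s : 'S_n) (c : Kqt) : msym s (c%:MP : Pol n) = c%:MP.
Proof. by rewrite /msym mmapC. Qed.

Lemma preg1_msym n (s : 'S_n) (f : Pol n) : preg1 f -> preg1 (msym s f).
Proof. by move=> rf m; rewrite mcoeff_sym. Qed.

Lemma DL_clear_denominator (R : comNzRingType) (t x y f sf d : R) :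
  (x - y) * d = f - sf ->
  (x - y) * (t * sf + (1 - t) * (y * d)) = (t * x - y) * sf + (1 - t) * y * f.
Proof.
move=> e; transitivity ((x - y) * t * sf + (1 - t) * y * ((x - y) * d)).
  by ring.
by rewrite e; ring.
Qed.

Section DemazureLusztig.

Variables (n k : nat).
Hypothesis hk : (k.+1 < n)%N.
Local Notation x := (xv n k).
Local Notation y := (xv n k.+1).
Implicit Types f g : Pol n.

Lemma xvB_neq0 : x - y != 0.
Proof. by rewrite (xv_lo hk) (xv_hi hk) subr_eq0 mpolyX_neq ?olo_neq_ohi. Qed.

Lemma msym_xv_lo : msym (stp n k) x = y.
Proof. by rewrite (xv_lo hk) (xv_hi hk) msym_X stp_lo. Qed.

Lemma msym_xv_hi : msym (stp n k) y = x.
Proof. by rewrite (xv_lo hk) (xv_hi hk) msym_X stp_hi. Qed.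

Lemma msym_stpK f : msym (stp n k) (msym (stp n k) f) = f.
Proof. by rewrite -msymMm stp2 // msym1m. Qed.

Lemma sactK f : sact k (sact k f) = f.
Proof. by rewrite !sactE msym_stpK. Qed.

(** The twisted Leibniz rule fg - s(f)s(g) = (f - s f) g + s(f) (g - s g) reduces divisibility to
    single variables, where the quotient is 1, -1 or 0. Regularity of the quotient is carried
    along. *)
Lemma ddiff_monomial_ex m :
  exists2 h : Pol n, (x - y) * h = 'X_[m] - sact k 'X_[m] & preg1 h.
Proof.
pose P f := [/\ preg1 f, preg1 (sact k f) &
  exists2 h : Pol n, (x - y) * h = f - sact k f & preg1 h].
suff: P 'X_[m] by case.
have P1 : P 1.
  rewrite /P sactE msym1; split; try exact: preg1_1.
  by exists 0; [rewrite mulr0 subrr | apply: preg1_0].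
have PM f g : P f -> P g -> P (f * g).
  move=> [rf rsf [h eh rh]] [rg rsg [h' eh' rh']]; rewrite /P.
  have -> : sact k (f * g) = sact k f * sact k g by rewrite !sactE msymM.
  split; try exact: preg1M.
  exists (h * g + sact k f * h').
    by rewrite mulrDr mulrA eh mulrCA eh' mulrBl mulrBr addrA subrK.
  by apply: preg1D; apply: preg1M.
have PX i : P 'X_i.
  rewrite /P sactE msym_X; split; try exact: preg1_monomial.
  rewrite (xv_lo hk) (xv_hi hk) stpE; case: tpermP => [->|->|_ _].
  - by exists 1; [rewrite mulr1 | apply: preg1_1].
  - by exists (- 1); [rewrite mulrN1 opprB | apply/preg1N/preg1_1].
  - by exists 0; [rewrite mulr0 subrr | apply: preg1_0].
have PXn e i : P ('X_i ^+ e).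
  elim: e => [|e ihe]; first by rewrite expr0.
  rewrite exprS; apply: PM; [exact: PX | exact: ihe].
rewrite mpolyXE_id.
apply: (big_ind P); [exact: P1 | exact: PM | move=> i _; exact: PXn].
Qed.

Lemma ddiff_ex f :
  exists2 h : Pol n, (x - y) * h = f - sact k f & preg1 f -> preg1 h.
Proof.
elim/mpolyind: f => [|c m p m_p _ [h eh rh]].
  by exists 0; rewrite ?mulr0 ?sactE ?msym0 ?subrr.
have [h' eh' rh'] := ddiff_monomial_ex m.
exists (c *: h' + h).
  rewrite mulrDr -scalerAr eh' eh !sactE msymD msymZ scalerBr.
  by rewrite opprD addrACA.
(* As m lies outside the support of p, the sum has coefficient c at m and agrees with p elsewhere,
   so both c and p inherit its regularity. *)
move=> rcp; have pm0 : p@_m = 0 by apply: memN_msupp_eq0.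
apply: preg1D.
  apply: preg1Z => //; have := rcp m.
  by rewrite mcoeffD mcoeffZ mcoeffX eqxx mulr1 pm0 addr0.
apply: rh => m'; case: (m' =P m) => [->|/eqP nm].
  by rewrite pm0; apply: reg1_0.
have := rcp m'; rewrite mcoeffD mcoeffZ mcoeffX.
by rewrite eq_sym (negbTE nm) mulr0 add0r.
Qed.

Lemma ddiff_eq f : (x - y) * ddiff k f = f - sact k f.
Proof.
apply: (@the_orP _ 0 (fun h : Pol n => (x - y) * h = f - sact k f)).
by have [h] := ddiff_ex f; exists h.
Qed.

Lemma ddiff_uniq f h : (x - y) * h = f - sact k f -> ddiff k f = h.
Proof. by move=> e; apply: (mulfI xvB_neq0); rewrite ddiff_eq. Qed.

Lemma preg1_ddiff f : preg1 f -> preg1 (ddiff k f).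
Proof. by have [h /ddiff_uniq -> rh] := ddiff_ex f. Qed.

Lemma preg1_sact f : preg1 f -> preg1 (sact k f).
Proof. by rewrite sactE; apply: preg1_msym. Qed.

Lemma preg1_xv j : preg1 (xv n j).
Proof.
by rewrite /xv; case: insubP => *; [apply: preg1_monomial | apply: preg1_0].
Qed.

Lemma preg1_DL f : preg1 f -> preg1 (DL k f).
Proof.
move=> rf; apply: preg1D; apply: preg1Z.
- exact: reg1_tt.
- exact: preg1_sact.
- by apply: reg1B; [apply: reg1_1 | apply: reg1_tt].
- by apply: preg1M; [apply: preg1_xv | apply: preg1_ddiff].
Qed.

Lemma is_DL_DL : is_DL (tt%:MP : Pol n) (msym (stp n k)) x y (@DL n k).
Proof.
move=> f; rewrite /DL -!mul_mpolyC mpolyCB mpolyC1 -sactE.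
exact/DL_clear_denominator/ddiff_eq.
Qed.

Lemma xv_neq : x != y.
Proof. by rewrite -subr_eq0 xvB_neq0. Qed.

Lemma DLD f g : DL k (f + g) = DL k f + DL k g.
Proof. exact: (is_DL_add _ _ is_DL_DL xv_neq). Qed.

Lemma DLZ c f : DL k (c *: f) = c *: DL k f.
Proof.
rewrite -!mul_mpolyC; apply: (is_DL_mul _ is_DL_DL xv_neq).
exact: msymC.
Qed.

Lemma DL0 : DL k (0 : Pol n) = 0.
Proof. by have := DLZ 0 0; rewrite !scale0r. Qed.

Lemma DL_quad f : DL k (DL k f) = (tt - 1) *: DL k f + tt *: f.
Proof.
rewrite -!mul_mpolyC mpolyCB mpolyC1.
apply: (DL_quadratic is_DL_DL); [exact: msymC | exact: msym_xv_lo |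
  exact: msym_xv_hi | exact: msym_stpK | exact: xv_neq].
Qed.

(** The quadratic relation (T - t)(T + 1) = 0 solved for the inverse: T^-1 = t^-1 (T - (t - 1)). *)
Lemma DLK f : tt^-1 *: (DL k (DL k f) - (tt - 1) *: DL k f) = f.
Proof.
by rewrite DL_quad addrAC subrr add0r scalerA mulVf ?scale1r ?tt_neq0.
Qed.

Lemma DL_inj : injective (@DL n k).
Proof. by move=> f g e; rewrite -[f]DLK e DLK. Qed.

Lemma DLinvE f : DLinv k f = tt^-1 *: (DL k f - (tt - 1) *: f).
Proof.
apply: the_or_uniq => [|h <-]; last by rewrite DLK.
by rewrite -scaleNr DLZ DLD DLZ scaleNr DLK.
Qed.

Lemma DLK_inv f : DL k (DLinv k f) = f.
Proof. by rewrite DLinvE -scaleNr DLZ DLD DLZ scaleNr DLK. Qed.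

Lemma DLinv_lin c f g : DLinv k (c *: f + g) = c *: DLinv k f + DLinv k g.
Proof. by apply: DL_inj; rewrite DLD DLZ !DLK_inv. Qed.

Lemma preg1_DLinv f : preg1 f -> preg1 (DLinv k f).
Proof.
move=> rf; rewrite DLinvE; apply: preg1Z; first exact: reg1V_tt.
apply: preg1B; first exact: preg1_DL.
by apply: preg1Z => //; apply: reg1B; [apply: reg1_tt | apply: reg1_1].
Qed.

End DemazureLusztig.

(** * Braid relations for transpositions and for the operators T_k *)

Lemma stp_val n k (j : 'I_n) : (k.+1 < n)%N ->
  val (stp n k j) =
    if val j == k then k.+1 else if val j == k.+1 then k else val j.
Proof.
move=> hk; rewrite (stpE hk).
case: tpermP => [->|->|/eqP + /eqP]; rewrite -?val_eqE /= ?eqxx //.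
  by rewrite gtn_eqF.
by move=> /negbTE -> /negbTE ->.
Qed.

Lemma stp_commute n i j : (i.+1 < j)%N -> (j.+1 < n)%N ->
  (stp n i * stp n j = stp n j * stp n i)%g.
Proof.
move=> ij hj; have hi : (i.+1 < n)%N by lia.
apply/permP => o; rewrite !permM; apply: val_inj.
rewrite (stp_val _ hj) (stp_val _ hi) (stp_val _ hi) (stp_val _ hj).
by do ![case: ifP]; lia.
Qed.

Lemma stp_braid n i : (i.+2 < n)%N ->
  (stp n i * stp n i.+1 * stp n i = stp n i.+1 * stp n i * stp n i.+1)%g.
Proof.
move=> hj; have hi := ltnW hj.
apply/permP => o; rewrite !permM; apply: val_inj.
rewrite !(stp_val _ hj, stp_val _ hi).
by do ![case: ifP]; lia.
Qed.

Lemma msym_stp_out n k (o : 'I_n) : (k.+1 < n)%N -> val o != k ->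
  val o != k.+1 -> msym (stp n k) ('X_o : Pol n) = 'X_o.
Proof. by move=> hk o1 o2; rewrite msym_X stp_out. Qed.

Lemma DL_braid_far n i j (f : Pol n) : (i.+1 < j)%N -> (j.+1 < n)%N ->
  DL i (DL j f) = DL j (DL i f).
Proof.
move=> ij hj; have hi : (i.+1 < n)%N by lia.
apply: (DL_commute (is_DL_DL hi) (is_DL_DL hj)); try exact: msymC.
- by rewrite (xv_lo hj); apply: msym_stp_out => //=; lia.
- by rewrite (xv_hi hj); apply: msym_stp_out => //=; lia.
- by rewrite (xv_lo hi); apply: msym_stp_out => //=; lia.
- by rewrite (xv_hi hi); apply: msym_stp_out => //=; lia.
- have E : msym (stp n i) (msym (stp n j) f) =
           msym (stp n j) (msym (stp n i) f).
    by rewrite -!msymMm (stp_commute ij hj).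
  exact: E.
- exact: xv_neq.
- exact: xv_neq.
Qed.

Lemma DL_braid_near n i (f : Pol n) : (i.+2 < n)%N ->
  DL i (DL i.+1 (DL i f)) = DL i.+1 (DL i (DL i.+1 f)).
Proof.
move=> hj; have hi := ltnW hj.
apply: (DL_braid (is_DL_DL hi) (is_DL_DL hj)); try exact: msymC.
- exact: msym_xv_lo.
- exact: msym_xv_hi.
- by rewrite (xv_hi hj); apply: msym_stp_out => //=; lia.
- by rewrite (xv_lo hi); apply: msym_stp_out => //=; lia.
- exact: msym_xv_lo.
- exact: msym_xv_hi.
- exact: msym_stpK.
- exact: msym_stpK.
- have E : msym (stp n i) (msym (stp n i.+1) (msym (stp n i) f)) =
           msym (stp n i.+1) (msym (stp n i) (msym (stp n i.+1) f)).
    by have := congr1 (fun s => msym s f) (stp_braid hj); rewrite !msymMm.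
  exact: E.
- exact: xv_neq.
- exact: xv_neq.
- by rewrite (xv_lo hi) (xv_hi hj); apply: mpolyX_neq; rewrite -val_eqE /=; lia.
Qed.

(** * Inversions and reduced words *)

Section PairCount.

Variable n : nat.
Implicit Types (P : rel 'I_n) (s : 'S_n).
Local Open Scope nat_scope.

(** Common form of [ninv] and [twinv], so that a single lemma describes the effect of s_k on
    both. *)
Definition npairs P := #|[set jm : 'I_n * 'I_n | (jm.1 < jm.2) && P jm.1 jm.2]|.

Lemma eq_npairs P Q : P =2 Q -> npairs P = npairs Q.
Proof. by move=> e; apply: eq_card => jm; rewrite !inE e. Qed.

(** The transposition permutes the increasing pairs other than (k, k+1) and reverses that one; the
    two correction terms account for it without subtraction. *)
Lemma npairs_stp P k (hk : k.+1 < n) :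
  npairs (fun a b => P (stp n k a) (stp n k b)) + P (olo hk) (ohi hk)
    = npairs P + P (ohi hk) (olo hk).
Proof.
have E Q : npairs Q = Q (olo hk) (ohi hk) +
    \sum_(p : 'I_n * 'I_n | (p.1 < p.2) && (p != (olo hk, ohi hk))) Q p.1 p.2.
  have -> : npairs Q = \sum_(p : 'I_n * 'I_n | p.1 < p.2) Q p.1 p.2.
    rewrite /npairs -sum1_card (eq_bigl
      (fun p : 'I_n * 'I_n => (p.1 < p.2) && Q p.1 p.2)).
      by rewrite big_mkcondr; apply: eq_bigr => p _; case: (Q _ _).
    by move=> p; rewrite inE.
  by rewrite (bigD1 (olo hk, ohi hk)) //=.
rewrite !E stp_lo stp_hi.
pose st (p : 'I_n * 'I_n) := (stp n k p.1, stp n k p.2).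
rewrite [X in _ = _ + X + _](reindex_inj (h := st)) /=; last first.
  by move=> [a b] [c d] [/perm_inj -> /perm_inj ->].
rewrite [X in _ + X + _ = _](eq_bigl (fun p : 'I_n * 'I_n =>
  (stp n k p.1 < stp n k p.2) && (st p != (olo hk, ohi hk)))).
  by rewrite [LHS]addnC addnCA [LHS]addnC.
move=> [a b] /=; rewrite !xpair_eqE -!val_eqE /=.
rewrite -[nat_of_ord (stp n k a)]/(val _) -[nat_of_ord (stp n k b)]/(val _).
rewrite !(stp_val _ hk) /=; move: (nat_of_ord a) (nat_of_ord b) => {}a {}b.
by do ![case: ifP]; lia.
Qed.

Definition ninv s := npairs (fun a b => s b < s a).

Lemma ninv_descent s k (hk : k.+1 < n) : s (ohi hk) < s (olo hk) ->
  ninv s = (ninv (stp n k * s)).+1.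
Proof.
move=> d; have := npairs_stp (fun a b => s b < s a) hk.
rewrite d (ltnNge (s (olo hk))) (ltnW d) addn0 /ninv => <-.
by rewrite addn1; congr _.+1; apply: eq_npairs => a b; rewrite !permM.
Qed.

Lemma ninv_ascent s k (hk : k.+1 < n) : s (olo hk) < s (ohi hk) ->
  ninv (stp n k * s) = (ninv s).+1.
Proof.
move=> d; rewrite (@ninv_descent (stp n k * s) k hk).
  by rewrite mulgA stp2 // mul1g.
by rewrite !permM stp_lo stp_hi.
Qed.

Lemma ascentE s k (hk : k.+1 < n) :
  (s (olo hk) < s (ohi hk)) = ~~ (s (ohi hk) < s (olo hk)).
Proof.
by rewrite -leqNgt ltn_neqAle (inj_eq val_inj) (inj_eq perm_inj) olo_neq_ohi.
Qed.

(** Letters out of range are included, with [stp] the identity there, because [reduced_word]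
    compares with arbitrary lists. *)
Lemma ninv_stpM_le s k : ninv (stp n k * s) <= (ninv s).+1.
Proof.
have [hk|hk] := boolP (k.+1 < n); last first.
  rewrite /stp; case: insubP => [a _ _|_]; last by rewrite mul1g.
  by rewrite insubN // mul1g.
have [d|d] := ltnP (s (ohi hk)) (s (olo hk)).
  by have := ninv_descent d; lia.
by rewrite (@ninv_ascent _ _ hk) // ascentE -leqNgt.
Qed.

Lemma ninv1 : ninv 1 = 0.
Proof.
apply/eqP; rewrite cards_eq0; apply/eqP/setP => -[a b].
by rewrite !inE /= !perm1; lia.
Qed.

(** An increasing s satisfies s(o) >= o by induction from the left end and s(o) <= o by induction
    from the right end. *)
Lemma no_descent_id s :
  (forall k (hk : k.+1 < n), s (olo hk) < s (ohi hk)) -> s = 1%g.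
Proof.
move=> asc.
have lb m (o : 'I_n) : val o = m -> m <= s o.
  elim: m o => // m ihm o om; have hm : m.+1 < n by rewrite -om ltn_ord.
  have -> : o = ohi hm by apply: val_inj.
  by apply: leq_ltn_trans (asc _ _); apply: ihm.
have ub m (o : 'I_n) : n - o = m.+1 -> s o <= o.
  elim: m o => [|m ihm] o om; first by have := ltn_ord (s o); lia.
  have ho : o.+1 < n by lia.
  have -> : o = olo ho by apply: val_inj.
  have := ihm (ohi ho); rewrite /= => /(_ _).
  have := asc _ ho; rewrite /=; lia.
apply/permP => o; rewrite perm1; apply/val_inj/eqP; rewrite eqn_leq.
by rewrite (ub (n - o).-1) ?lb //; have := ltn_ord o; lia.
Qed.

End PairCount.

Section Words.

Variable n : nat.
Implicit Types (s : 'S_n) (w : seq nat).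
Local Open Scope nat_scope.

Definition valid_word w := all (fun k => k.+1 < n) w.

Lemma word_perm_rcons w k :
  word_perm n (rcons w k) = (stp n k * word_perm n w)%g.
Proof.
elim: w => [|j w ihw] /=; first by rewrite /pmul mul1g mulg1.
by rewrite ihw /pmul mulgA.
Qed.

Lemma ninv_word w : ninv (word_perm n w) <= size w.
Proof.
elim/last_ind: w => [|w k ihw]; first by rewrite ninv1.
rewrite word_perm_rcons size_rcons; apply: leq_trans (ninv_stpM_le _ _) _.
by rewrite ltnS.
Qed.

(** Bubble sort: each descent removed lowers [ninv] by one, and a permutation without descents is
    the identity. *)
Lemma ninv_word_ex s :
  exists w, [/\ valid_word w, word_perm n w = s & size w = ninv s].
Proof.
move e: (ninv s) => N; elim: N s e => [|N ihN] s e.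
  exists [::]; split=> //=; apply/esym/no_descent_id => k hk.
  by rewrite ascentE; apply/negP => /ninv_descent; rewrite e.
have [k [hk d]] : exists k, exists hk : k.+1 < n, s (ohi hk) < s (olo hk).
  apply: Classical_Prop.NNPP => nd; suff s1 : s = 1%g by rewrite s1 ninv1 in e.
  apply: no_descent_id => k hk; rewrite ascentE; apply/negP => d.
  by case: nd; exists k, hk.
have [|w [vw ew sw]] := ihN (stp n k * s)%g.
  by have := ninv_descent d; rewrite e => -[].
exists (rcons w k); split.
- by rewrite /valid_word all_rcons hk.
- by rewrite word_perm_rcons ew mulgA stp2 // mul1g.
- by rewrite size_rcons sw.
Qed.

(** Replaces minimality among all words by an equation on the length, since Coxeter length is the
    number of inversions. *)
Lemma reduced_wordP w s : reduced_word w s <->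
  [/\ valid_word w, word_perm n w = s & size w = ninv s].
Proof.
split=> [[vw ew mw]|[vw ew sw]]; split=> //.
  have [w' [vw' ew' sw']] := ninv_word_ex s.
  by apply/eqP; rewrite eqn_leq -{1}sw' mw //= -ew ninv_word.
by move=> w' ew'; rewrite sw -ew' ninv_word.
Qed.

End Words.

(** * Matsumoto's theorem: T_sigma is independent of the reduced word *)

Section Matsumoto.

Variable n : nat.
Implicit Types (s : 'S_n) (w : seq nat) (f : Pol n).

Lemma reduced_word_ex s : exists w, reduced_word w s.
Proof. by have [w /reduced_wordP] := ninv_word_ex s; exists w. Qed.

(** If the last letter were an ascent of s, removing it would give a permutation with more
    inversions than there are letters left. *)
Lemma reduced_rconsP w k s : reduced_word (rcons w k) s <->
  exists hk : (k.+1 < n)%N,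
    (s (ohi hk) < s (olo hk))%N /\ reduced_word w (stp n k * s)%g.
Proof.
split=> [/reduced_wordP|[hk [d /reduced_wordP[vw ew sw]]]]; last first.
  apply/reduced_wordP.
  rewrite /valid_word all_rcons word_perm_rcons size_rcons.
  split; first by rewrite hk.
    by rewrite ew mulgA stp2 // mul1g.
  by rewrite (ninv_descent d) sw.
rewrite /valid_word all_rcons word_perm_rcons size_rcons.
move=> -[/andP[hk vw] ew sw].
exists hk; have ew' : word_perm n w = (stp n k * s)%g.
  by rewrite -ew mulgA stp2 // mul1g.
have le_w := ninv_word n w; rewrite ew' in le_w.
have d : (s (ohi hk) < s (olo hk))%N.
  by apply: contraT; rewrite -ascentE => /ninv_ascent; lia.
by split=> //; apply/reduced_wordP; split=> //; have := ninv_descent d; lia.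
Qed.

Lemma DLword_rcons w k f : DLword (rcons w k) f = DLword w (DL k f).
Proof. by rewrite /DLword foldr_rcons. Qed.

(** Induction on the length, comparing the last letters i and j. Both are descents of s, so when
    they differ s has reduced words ending in the two sides of the braid relation between i and j,
    and the operators satisfy that relation. *)
Lemma DLword_reduced w w' s f :
  reduced_word w s -> reduced_word w' s -> DLword w f = DLword w' f.
Proof.
move: {2}(size w).+1 (ltnSn (size w)) => N.
elim: N => // N ihN in w w' s f *.
have size_eq v v' s' :
    reduced_word v s' -> reduced_word v' s' -> size v = size v'.
  by move=> /reduced_wordP[_ _ ->] /reduced_wordP[_ _ ->].
move=> ltN rw rw'; have sz := size_eq _ _ _ rw rw'.
case/lastP: w rw sz ltN => [|u i] rw sz ltN.
  by case: w' {rw'} sz.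
case/lastP: w' rw' sz => [|u' j] rw' sz; first by rewrite size_rcons in sz.
rewrite !size_rcons in sz ltN; case: sz => sz; rewrite ltnS in ltN.
wlog le_ij : i j u u' rw rw' sz ltN / (i <= j)%N.
  move=> WL; case: (leqP i j) => [|/ltnW] le_ij; first exact: WL.
  by apply/esym/WL; rewrite // -sz.
have [hi [di ru]] := (reduced_rconsP _ _ _).1 rw.
have [hj [dj ru']] := (reduced_rconsP _ _ _).1 rw'.
rewrite !DLword_rcons; move: le_ij; rewrite leq_eqVlt => /orP[/eqP eij|lt_ij].
  by subst j; apply: ihN ru ru'.
move: lt_ij; rewrite leq_eqVlt => /orP[/eqP eij|lt_ij].
  subst j.
  have e12 : ohi hi = olo hj by apply: val_inj.
  have fixlo : stp n i.+1 (olo hi) = olo hi by apply: stp_out => //=; lia.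
  have fixhi : stp n i (ohi hj) = ohi hj by apply: stp_out => //=; lia.
  (* With descents at both i and i+1, v extends to reduced words of s ending in i, i+1, i and in
     i+1, i, i+1. *)
  have [v rv] := reduced_word_ex (stp n i * (stp n i.+1 * (stp n i * s)))%g.
  have rv1 : reduced_word (rcons (rcons v i) i.+1) (stp n i * s)%g.
    apply/reduced_rconsP; exists hj; split.
      by rewrite !permM fixhi -e12 stp_hi (ltn_trans dj) // -e12.
    apply/reduced_rconsP; exists hi; split=> //.
    by rewrite !permM fixlo stp_lo e12 stp_lo fixhi.
  have rv2 : reduced_word (rcons (rcons v i.+1) i) (stp n i.+1 * s)%g.
    apply/reduced_rconsP; exists hi; split.
      by rewrite !permM fixlo e12 stp_lo (ltn_trans dj) // -e12.
    apply/reduced_rconsP; exists hj; split.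
      by rewrite !permM -e12 stp_hi fixhi fixlo stp_hi -e12.
    by rewrite !mulgA -(stp_braid hj) -!mulgA.
  transitivity (DLword (rcons (rcons v i) i.+1) (DL i f)).
    exact: ihN ltN ru rv1.
  transitivity (DLword (rcons (rcons v i.+1) i) (DL i.+1 f)); last first.
    by apply/esym; apply: ihN ru' rv2; rewrite -sz.
  transitivity (DLword v (DL i (DL i.+1 (DL i f)))).
    by rewrite [LHS]DLword_rcons [LHS]DLword_rcons.
  transitivity (DLword v (DL i.+1 (DL i (DL i.+1 f)))).
    exact: (congr1 (DLword v) (DL_braid_near f hj)).
  by rewrite [RHS]DLword_rcons [RHS]DLword_rcons.
have fi (o : 'I_n) : (val o == j) || (val o == j.+1) -> stp n i o = o.
  by case/orP=> /eqP e; apply: stp_out; rewrite // e; lia.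
have fj (o : 'I_n) : (val o == i) || (val o == i.+1) -> stp n j o = o.
  by case/orP=> /eqP e; apply: stp_out; rewrite // e; lia.
(* Here s_i and s_j commute, and v extends to reduced words of s ending in j, i and in i, j. *)
have [v rv] := reduced_word_ex (stp n j * (stp n i * s))%g.
have rv1 : reduced_word (rcons v j) (stp n i * s)%g.
  apply/reduced_rconsP; exists hj; split=> //.
  by rewrite !permM !fi /= ?eqxx ?orbT.
have rv2 : reduced_word (rcons v i) (stp n j * s)%g.
  apply/reduced_rconsP; exists hi; split.
    by rewrite !permM !fj /= ?eqxx ?orbT.
  by rewrite mulgA (stp_commute lt_ij hj) -mulgA.
transitivity (DLword (rcons v j) (DL i f)); first exact: ihN ltN ru rv1.
transitivity (DLword (rcons v i) (DL j f)); last first.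
  by apply/esym; apply: ihN ru' rv2; rewrite -sz.
rewrite [LHS]DLword_rcons [RHS]DLword_rcons.
exact: (congr1 (DLword v) (esym (DL_braid_far f lt_ij hj))).
Qed.

Lemma DLperm_reduced w s f : reduced_word w s -> DLperm s f = DLword w f.
Proof.
move=> rw; apply: DLword_reduced rw.
exact: (@the_orP _ [::] (fun w => reduced_word w s) (reduced_word_ex s)).
Qed.

(** As [stp n k * s] is the permutation s s_k in the convention of [pmul], this is the factorization
    T_s = T_(s s_k) T_k. *)
Lemma DLperm_descent s k (hk : (k.+1 < n)%N) f : (s (ohi hk) < s (olo hk))%N ->
  DLperm s f = DLperm (stp n k * s)%g (DL k f).
Proof.
move=> d; have [w rw] := reduced_word_ex (stp n k * s)%g.
rewrite (DLperm_reduced _ rw) (@DLperm_reduced (rcons w k)) ?DLword_rcons //.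
by apply/reduced_rconsP; exists hk.
Qed.

Lemma DLpermZ s c f : DLperm s (c *: f) = c *: DLperm s f.
Proof.
have [w rw] := reduced_word_ex s; rewrite !(DLperm_reduced _ rw).
case: rw => + _ _; elim: w => //= k w ihw /andP[hk /ihw ->].
by rewrite DLZ.
Qed.

End Matsumoto.

(** * Specialization of the Cherednik operators at t = 1 *)

Section SpecializationAtOne.

Variable n : nat.
Implicit Types (f g h : Pol n).

(** Congruence modulo 1 - t over the functions regular at t = 1. For regular polynomials it
    expresses equality of the specializations, which are thus never constructed. *)
Definition cong1 f g := preg1 ((1 - tt)^-1 *: (f - g)).

Lemma cong1_refl f : cong1 f f.
Proof. by rewrite /cong1 subrr scaler0; apply: preg1_0. Qed.

Lemma cong1_trans g f h : cong1 f g -> cong1 g h -> cong1 f h.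
Proof.
move=> fg gh; have := preg1D fg gh; rewrite -scalerDr addrA subrK; exact.
Qed.

Lemma cong1_sym f g : cong1 f g -> cong1 g f.
Proof. by move=> /preg1N; rewrite -scalerN opprB. Qed.

Lemma cong1Z c f g : reg1 c -> cong1 f g -> cong1 (c *: f) (c *: g).
Proof.
move=> rc /(preg1Z rc); rewrite scalerA mulrC -scalerA scalerBr; exact.
Qed.

Lemma cong1_ttX e f : preg1 f -> cong1 (tt ^+ e *: f) f.
Proof.
move=> rf; elim: e => [|e ihe].
  by rewrite expr0 scale1r; apply: cong1_refl.
have rt := reg1_tt.
apply: (cong1_trans _ ihe).
rewrite exprS -scalerA /cong1; set g := _ *: f.
have -> : tt *: g - g = (1 - tt) *: (- g).
  by rewrite scalerN scalerBl scale1r opprB.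
rewrite scalerA mulVf ?one_sub_tt_neq0 // scale1r; apply: preg1N.
by apply: preg1Z => //; apply: reg1X.
Qed.

Lemma substD phi f g : subst phi (f + g) = subst phi f + subst phi g :> Pol n.
Proof. exact: comp_mpolyD. Qed.

Lemma substZ phi c f : subst phi (c *: f) = c *: subst phi f :> Pol n.
Proof. exact: comp_mpolyZ. Qed.

Lemma substB phi f g : subst phi (f - g) = subst phi f - subst phi g :> Pol n.
Proof. exact: comp_mpolyB. Qed.

Lemma substM phi f g : subst phi (f * g) = subst phi f * subst phi g :> Pol n.
Proof. exact: rmorphM. Qed.

Lemma substC phi c : subst phi c%:MP = c%:MP :> Pol n.
Proof. exact: comp_mpolyC. Qed.

Lemma substX phi i : subst phi 'X_i = phi i :> Pol n.
Proof. by rewrite /subst comp_mpolyXU -tnth_nth tnth_mktuple. Qed.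

Lemma cong1_subst phi f g : (forall i, preg1 (phi i)) ->
  cong1 f g -> cong1 (subst phi f) (subst phi g).
Proof.
move=> rphi /(preg1_subst rphi); rewrite substZ substB; exact.
Qed.

Lemma cong1_sact k f g : cong1 f g -> cong1 (sact k f) (sact k g).
Proof. by apply: cong1_subst => i; apply: preg1_monomial. Qed.

Lemma preg1_gop_var (j : 'I_n) :
  preg1 (if (j.+1 < n)%N then xv n j.+1 else qq^-1 *: xv n 0).
Proof.
case: ifP => _; first exact: preg1_xv.
by apply: preg1Z; [apply: reg1V_qq | apply: preg1_xv].
Qed.

Lemma preg1_gop f : preg1 f -> preg1 (gop f).
Proof. by apply: preg1_subst; apply: preg1_gop_var. Qed.

Lemma cong1_gop f g : cong1 f g -> cong1 (gop f) (gop g).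
Proof. by apply: cong1_subst; apply: preg1_gop_var. Qed.

(** The difference T_k - s_k is 1 - t times the operator x_(k+1) [ddiff] - s_k, which preserves
    regularity. *)
Lemma cong1_DL k f : (k.+1 < n)%N -> preg1 f -> cong1 (DL k f) (sact k f).
Proof.
move=> hk rf; rewrite /cong1.
have -> : DL k f - sact k f = (1 - tt) *: (xv n k.+1 * ddiff k f - sact k f).
  rewrite /DL scalerBr [_ *: sact k f + _]addrC -addrA; congr (_ + _).
  by rewrite scalerBl scale1r opprB.
rewrite scalerA mulVf ?one_sub_tt_neq0 // scale1r; apply: preg1B.
  by apply: preg1M; [apply: preg1_xv | apply: preg1_ddiff].
exact: preg1_sact.
Qed.

Lemma cong1_DLinv k f : (k.+1 < n)%N -> preg1 f -> cong1 (DLinv k f) (sact k f).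
Proof.
move=> hk rf; have := cong1_DL hk (preg1_DLinv hk rf).
rewrite (DLK_inv hk f) => /(@cong1_sact k)/cong1_sym.
by rewrite (sactK hk (DLinv k f)); apply.
Qed.

Section FoldWord.

Variable T : nat -> Pol n -> Pol n.
Hypothesis T_preg1 : forall k f, (k.+1 < n)%N -> preg1 f -> preg1 (T k f).
Hypothesis T_cong1 :
  forall k f, (k.+1 < n)%N -> preg1 f -> cong1 (T k f) (sact k f).

Lemma preg1_foldl w f : valid_word n w -> preg1 f ->
  preg1 (foldl (fun acc k => T k acc) f w).
Proof. by elim: w f => //= k w ihw f /andP[hk vw] rf; apply/ihw/T_preg1. Qed.

Lemma cong1_foldl_sact w f g : cong1 f g ->
  cong1 (foldl (fun acc k => sact k acc) f w)
        (foldl (fun acc k => sact k acc) g w).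
Proof. by elim: w f g => //= k w ihw f g fg; apply/ihw/cong1_sact. Qed.

(** The generic [T] lets the same argument serve [DL] and [DLinv], both congruent to s_k. *)
Lemma cong1_foldl w f : valid_word n w -> preg1 f ->
  cong1 (foldl (fun acc k => T k acc) f w)
        (foldl (fun acc k => sact k acc) f w).
Proof.
elim: w f => /= [|k w ihw] f; first by move=> *; apply: cong1_refl.
move=> /andP[hk vw] rf; apply: cong1_trans (ihw _ vw (T_preg1 hk rf)) _.
exact/cong1_foldl_sact/T_cong1.
Qed.

End FoldWord.

(** The value of Y_j at t = 1, with every T_k and T_k^-1 replaced by s_k. Unlike Y_j it is
    multiplicative, so it is determined on variables. *)
Definition Yop1 j f :=
  foldl (fun acc k => sact k acc)
    (gop (foldl (fun acc k => sact k acc) f (iota j (n.-1 - j)))) (iota 0 j).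

Lemma valid_iota j m : (j + m < n)%N -> valid_word n (iota j m).
Proof. by move=> jm; apply/allP => k; rewrite mem_iota; lia. Qed.

Lemma cong1_Yop j f : (j < n)%N -> preg1 f -> cong1 (Yop j f) (Yop1 j f).
Proof.
move=> jn rf.
have v1 : valid_word n (iota j (n.-1 - j)) by apply: valid_iota; lia.
have v2 : valid_word n (iota 0 j) by apply: valid_iota.
have r1 : preg1 (foldl (fun acc k => DL k acc) f (iota j (n.-1 - j))).
  by apply: preg1_foldl => // k g hk; apply: preg1_DL.
have r2 := preg1_gop r1.
rewrite /Yop; apply: (cong1_trans (cong1_ttX _ _)).
  by apply: preg1_foldl => // k g hk; apply: preg1_DLinv.
apply: (cong1_trans (cong1_foldl _ _ v2 r2)).
- by move=> k g hk; apply: preg1_DLinv.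
- by move=> k g hk; apply: cong1_DLinv.
apply/cong1_foldl_sact/cong1_gop/cong1_foldl => // k g hk.
- exact: preg1_DL.
- exact: cong1_DL.
Qed.

Lemma foldl_sactE w f : foldl (fun acc k => sact k acc) f w =
  msym (foldl (fun p k => (p * stp n k)%g) 1%g w) f.
Proof.
elim/last_ind: w => [|w k ihw]; first by rewrite /= msym1m.
rewrite !foldl_rcons ihw.
rewrite [RHS]msymMm.
exact: sactE.
Qed.

(** The product is a cycle: successive factors carry j up to j + m, and each position passed on the
    way moves down by one. *)
Lemma stp_iota_val j m (o : 'I_n) : (j + m < n)%N ->
  val (foldl (fun p k => (p * stp n k)%g) 1%g (iota j m) o) =
  if (o < j)%N || (j + m < o)%N then val o
  else if val o == j then (j + m)%N else (val o).-1.
Proof.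
elim: m => [|m ihm] jm.
  rewrite /= perm1 addn0; case: ifP => // /negbT; rewrite negb_or -!leqNgt.
  case/andP=> h1 h2; rewrite eqn_leq h1 h2 /=.
  by apply/eqP; rewrite eqn_leq h1 h2.
have jm' : (j + m < n)%N by lia.
have jm2 : ((j + m).+1 < n)%N by lia.
rewrite -addn1 iotaD cats1 foldl_rcons permM (stp_val _ jm2) (ihm jm') /=.
by move: (nat_of_ord o) => u {ihm}; do ![case: ifP]; lia.
Qed.

Lemma gop_lt (j : 'I_n) (hj : (j.+1 < n)%N) :
  gop ('X_j : Pol n) = 'X_(Ordinal hj).
Proof. by rewrite /gop substX /= hj /xv (insubT (fun i => i < n)%N hj). Qed.

Lemma gop_last (j : 'I_n) (n0 : (0 < n)%N) : (n <= j.+1)%N ->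
  gop ('X_j : Pol n) = qq^-1 *: 'X_(Ordinal n0).
Proof.
move=> hj; rewrite /gop substX /= ltnNge hj /xv.
by rewrite (insubT (fun i => i < n)%N n0).
Qed.

Lemma Yop1E j f : Yop1 j f =
  msym (foldl (fun p k => (p * stp n k)%g) 1%g (iota 0 j))
    (gop (msym (foldl (fun p k => (p * stp n k)%g) 1%g (iota j (n.-1 - j))) f)).
Proof. by rewrite /Yop1 [LHS]foldl_sactE foldl_sactE. Qed.

Lemma Yop1D j f g : Yop1 j (f + g) = Yop1 j f + Yop1 j g.
Proof. by rewrite !Yop1E msymD [gop _]substD msymD. Qed.

Lemma Yop1Z j c f : Yop1 j (c *: f) = c *: Yop1 j f.
Proof. by rewrite !Yop1E msymZ [gop _]substZ msymZ. Qed.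

Lemma Yop1M j f g : Yop1 j (f * g) = Yop1 j f * Yop1 j g.
Proof. by rewrite !Yop1E msymM [gop _]substM msymM. Qed.

Lemma Yop1_1 j : Yop1 j 1 = 1.
Proof. by rewrite Yop1E msym1 -mpolyC1 [gop _]substC mpolyC1 msym1. Qed.

(** The first cycle lowers the indices above j and sends j to the end, [gop] raises all indices by
    one, and the second cycle undoes the shift. Only x_j passes the end, where it wraps around to
    x_0 and picks up 1/q. *)
Lemma Yop1_X (j o : 'I_n) :
  Yop1 j 'X_o = (if o == j then qq^-1 else 1) *: 'X_o.
Proof.
have jn := ltn_ord j.
have h1 : (j + (n.-1 - j) < n)%N by lia.
have h2 : (0 + j < n)%N by [].
have n0 : (0 < n)%N by lia.
rewrite Yop1E msym_X.
set p := foldl _ _ (iota j _); set p' := foldl _ _ (iota 0 _).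
have pv u := stp_iota_val u h1; rewrite -/p in pv.
have pv' u := stp_iota_val u h2; rewrite -/p' in pv'.
have pw : val (p o) =
    if (o < j)%N then val o else if val o == j then n.-1 else (val o).-1.
  rewrite pv; have := ltn_ord o; move: (nat_of_ord o) => u.
  by do ![case: ifP]; lia.
case: (eqVneq o j) => [oj|oj].
  rewrite (@gop_last _ n0); last first.
    by rewrite -[nat_of_ord (p o)]/(val _) pw oj ltnn eqxx; lia.
  rewrite msymZ msym_X; congr (_ *: 'X_ _); apply: val_inj.
  by rewrite pv' /= oj; case: (nat_of_ord j).
have lt : ((p o).+1 < n)%N.
  have := ltn_ord o; rewrite -[nat_of_ord (p o)]/(val _) pw.
  move: oj; rewrite -val_eqE /=; move: (nat_of_ord o) => u.
  by do ![case: ifP]; lia.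
rewrite (gop_lt lt) msym_X scale1r; congr 'X_ _; apply: val_inj.
rewrite pv' /= -[nat_of_ord (p o)]/(val _) pw; move: oj; rewrite -val_eqE /=.
by move: (nat_of_ord o) => u; do ![case: ifP]; lia.
Qed.

Lemma Yop1_monomial (j : 'I_n) m : Yop1 j 'X_[m] = qq ^- m j *: 'X_[m].
Proof.
have YX o e : Yop1 j ('X_o ^+ e) =
    (if o == j then qq^-1 else 1) ^+ e *: 'X_o ^+ e.
  elim: e => [|e ihe]; first by rewrite !expr0 scale1r Yop1_1.
  by rewrite !exprS Yop1M ihe Yop1_X -scalerAl -scalerAr scalerA.
rewrite [in LHS]mpolyXE_id [in RHS]mpolyXE_id.
have -> : Yop1 j (\prod_(i < n) 'X_i ^+ m i) =
    \prod_(i < n) Yop1 j ('X_i ^+ m i).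
  by apply: (big_morph _ (Yop1M j) (Yop1_1 j)).
under eq_bigr do rewrite YX.
rewrite scaler_prod; congr (_ *: _).
rewrite (bigD1 j) //= eqxx exprVn big1 ?mulr1 // => i /negbTE ->.
by rewrite expr1n.
Qed.

Lemma mcoeff_Yop1 (j : 'I_n) f m : (Yop1 j f)@_m = qq ^- m j * f@_m.
Proof.
elim/mpolyind: f => [|c m' p _ _ ihp].
  have -> : Yop1 j (0 : Pol n) = 0 by have := Yop1Z j 0 0; rewrite !scale0r.
  by rewrite mcoeff0 mulr0.
rewrite Yop1D Yop1Z Yop1_monomial !mcoeffD ihp mulrDr; congr (_ + _).
rewrite !mcoeffZ mcoeffX; case: eqP => [->|_]; last by rewrite !mulr0.
by rewrite !mulr1 mulrC.
Qed.

(* Modulo [1 - t], the operator [Y_k] becomes [x_k := x_k / q], so that [h]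
   only has monomials with [x_k]-exponent [e], whereas [T_k] becomes [s_k]. *)
Lemma preg1_descent k (hk : (k.+1 < n)%N) e c h : preg1 h ->
    DL k h = - h -> Yop k h = (qq ^- e * tt ^+ c) *: h ->
  preg1 ((1 - tt)^-1 *: h).
Proof.
move=> rh Th Yh; pose v := (1 - tt)^-1.
(* Comparing coefficients in q^-e h = Y_k h modulo 1 - t gives (q^-e - q^-m_k) h_m = 0, and the
   factor is invertible at t = 1. *)
have Ye (m : 'X_{1..n}) : m (olo hk) != e -> reg1 (v * h@_m).
  move=> me.
  have rq : reg1 (qq ^- e) by rewrite -exprVn; apply/reg1X/reg1V_qq.
  have := cong1_trans (cong1_sym (cong1Z rq (cong1_ttX c rh)))
    (cong1_trans _ (cong1_Yop (ltn_ord (olo hk)) rh)).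
  rewrite /= Yh -scalerA => /(_ (cong1_refl _)) /(_ m).
  rewrite mcoeffZ mcoeffB mcoeffZ -[k]/(nat_of_ord (olo hk)).
  rewrite mcoeff_Yop1 -mulrBl => rm.
  rewrite eq_sym in me; have := reg1M (reg1V_qqXB me) rm.
  have nz : qq ^- e - qq ^- m (olo hk) != 0.
    rewrite subr_eq0 (inj_eq invr_inj) /qq -!tofracXn tofrac_eq -!polyC_exp.
    rewrite (inj_eq polyC_inj); apply: contra me => /eqP.
    move/(congr1 (fun p : {poly rat} => size p)).
    by rewrite !size_polyXn => -[->].
  by rewrite mulrCA mulKf.
(* Since T_k h = -h and T_k is congruent to s_k, the sum h + s_k h vanishes modulo 1 - t. *)
have Se m : reg1 (v * (h@_m + h@_[multinom m (stp n k i) | i < n])).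
  have := reg1N (cong1_DL hk rh m); rewrite Th sactE mcoeffZ mcoeffB mcoeffN.
  by rewrite mcoeff_sym -mulrN opprD !opprK.
move=> m; rewrite mcoeffZ.
case: (eqVneq (m (olo hk)) e) => [mk|]; last exact: Ye.
have := Se m; set m' := [multinom _ | i < n].
(* If both exponents equal e, then s_k fixes m and 2 is inverted; otherwise the swapped monomial has
   x_k-exponent different from e and [Ye] applies to it. *)
case: (eqVneq (m (ohi hk)) e) => [mk'|mk'].
  have -> : m' = m.
    apply/mnmP => i; rewrite mnmE stpE.
    by case: tpermP => // ->; rewrite mk mk'.
  have := reg1V_nat 1 => r2 /(reg1M r2).
  rewrite -mulr2n -(mulr_natl (h@_m)) mulrCA mulKf //.
  exact: natS_neq0.
have := Ye m'; rewrite mnmE stp_lo => /(_ mk') /reg1N rm' /reg1D /(_ rm').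
by rewrite mulrDr addrK.
Qed.

End SpecializationAtOne.

(** * Linearity and recursion of the operators Y_j, and vanishing of antisymmetric eigenvectors *)

Section CherednikOperators.

Variable n : nat.
Implicit Types (f g h : Pol n).

Lemma foldl_lin (T : nat -> Pol n -> Pol n) w c f g : valid_word n w ->
    (forall k d u v, (k.+1 < n)%N -> T k (d *: u + v) = d *: T k u + T k v) ->
  foldl (fun acc k => T k acc) (c *: f + g) w =
    c *: foldl (fun acc k => T k acc) f w + foldl (fun acc k => T k acc) g w.
Proof.
move=> + linT; elim: w f g => //= k w ihw f g /andP[hk vw].
by rewrite linT // ihw.
Qed.

Lemma Yop_lin j c f g : (j < n)%N ->
  Yop j (c *: f + g) = c *: Yop j f + Yop j g.
Proof.
move=> jn; rewrite /Yop.
rewrite (foldl_lin (T := @DL n)); [|by apply: valid_iota; lia|]; last first.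
  by move=> k d u v hk; rewrite DLD // DLZ.
rewrite {1}/gop substD substZ -/(gop _) -/(gop _).
rewrite (foldl_lin (T := @DLinv n)); [|exact: valid_iota|]; last first.
  by move=> k d u v hk; apply: DLinv_lin.
by rewrite scalerDr !scalerA mulrC.
Qed.

Lemma YopZ j c f : (j < n)%N -> Yop j (c *: f) = c *: Yop j f.
Proof.
move=> jn; have Y0 : Yop j (0 : Pol n) = 0.
  by have := Yop_lin (-1) 0 0 jn; rewrite !scaleN1r oppr0 addr0 addNr.
by have := Yop_lin c f 0 jn; rewrite Y0 !addr0.
Qed.

Lemma YopBZ j c f g : (j < n)%N -> Yop j (f - c *: g) = Yop j f - c *: Yop j g.
Proof.
move=> jn; rewrite addrC -scaleNr (Yop_lin (- c) g f jn).
by rewrite scaleNr addrC.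
Qed.

(** The T_k that Y_k applies first cancels the inner T_k^-1; the outer T_k^-1 and the factor t
    complete the prefix of Y_(k+1). *)
Lemma YopS k f : (k.+1 < n)%N ->
  Yop k.+1 f = tt *: DLinv k (Yop k (DLinv k f)).
Proof.
move=> hk; have e : (n.-1 - k = (n.-1 - k.+1).+1)%N by lia.
rewrite /Yop e.
have -> : foldl (fun acc i => DL i acc) (DLinv k f) (iota k (n.-1 - k.+1).+1) =
    foldl (fun acc i => DL i acc) f (iota k.+1 (n.-1 - k.+1)).
  by rewrite /= (DLK_inv hk f).
have -> : iota 0 k.+1 = rcons (iota 0 k) k by rewrite -addn1 iotaD cats1.
rewrite foldl_rcons; set u := foldl _ _ (iota 0 k).
have DLinvZ c v : DLinv k (c *: v) = c *: DLinv k v :> Pol n.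
  apply: (DL_inj hk); rewrite DLZ // !DLK_inv //.
by rewrite DLinvZ scalerA exprS.
Qed.

(** Both hypotheses are linear in h, so once the poles are cleared [preg1_descent] can be iterated:
    dividing by any power of 1 - t keeps the polynomial regular, which forces h = 0. *)
Lemma antisymmetric_eigen_eq0 k (hk : (k.+1 < n)%N) e c h :
  DL k h = - h -> Yop k h = (qq ^- e * tt ^+ c) *: h -> h = 0.
Proof.
move=> Th Yh; have [d nd rd] := preg1_scale h.
have reg N : preg1 ((1 - tt) ^- N *: (d *: h)).
  elim: N => [|N ihN]; first by rewrite expr0 invr1 scale1r.
  rewrite exprS invfM -scalerA.
  apply: (preg1_descent hk (e := e) (c := c) ihN).
    by rewrite !DLZ // Th !scalerN.
  have k_lt := ltnW hk.
  rewrite (YopZ _ _ k_lt) (YopZ _ _ k_lt) Yh !scalerA; congr (_ *: h).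
  by rewrite mulrC mulrA.
apply/mpolyP => m; rewrite mcoeff0; apply: (mulfI nd); rewrite mulr0.
apply: reg1_divisible_eq0 => N; have := reg N m.
by rewrite !mcoeffZ mulrC.
Qed.

End CherednikOperators.

(** * Equal adjacent parts *)

(** Used with v = f, u = T_k f and w = Y_k T_k f; the premise is t Y_k T_k^-1 f = b T_k f with
    T_k^-1 expanded and Y_k f = t b f. *)
Lemma eigen_comb (K : fieldType) (V : lmodType K) (t b : K) (u v w : V) :
  t != 0 -> t *: (t^-1 *: (w - (t - 1) *: ((t * b) *: v))) = b *: u ->
  w - t *: ((t * b) *: v) = b *: (u - t *: v).
Proof.
move=> nt; rewrite [t *: (t^-1 *: _)]scalerA divff // scale1r => e.
have -> : w = b *: u + (t - 1) *: ((t * b) *: v) by rewrite -e subrK.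
rewrite scalerBr -addrA !scalerA -scalerBl; congr (_ + _).
by rewrite -scaleNr; congr (_ *: _); ring.
Qed.

Lemma quadratic_comb (K : fieldType) (V : lmodType K) (t : K) (u v : V) :
  (t - 1) *: u + t *: v - t *: u = - (u - t *: v).
Proof.
by rewrite scalerBl scale1r opprB addrAC [_ - u - _]addrAC subrr add0r addrC.
Qed.

(** The weak inequality to the right counts k+1 for position k, while the strict inequality to the
    left does not count k for position k+1. *)
Lemma kexp_eq n (a : 'X_{1..n}) k (hk : (k.+1 < n)%N) :
  a (olo hk) = a (ohi hk) -> kexp a (olo hk) = (kexp a (ohi hk)).+1.
Proof.
move=> ea; rewrite /kexp -addnS; congr (_ + _)%N.
  apply: eq_card => m; rewrite !inE ea /= [in RHS]ltnS [in RHS]leq_eqVlt.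
  case: eqP => [mk|//]; have -> : m = olo hk by apply: val_inj.
  by rewrite ea ltnn ltnn.
set A := [set m | _ & _]; set B := [set m | _ & _].
have -> : A = ohi hk |: B.
  apply/setP => m; rewrite !inE ea /=; case: (eqVneq m (ohi hk)) => [->|mk].
    by rewrite /= ltnSn leqnn.
  by congr (_ && _); move: mk; rewrite -val_eqE /=; lia.
by rewrite cardsU1 inE ltnn.
Qed.

(** By [kexp_eq] the eigenvalues of Y_k and Y_(k+1) on f = E_a are t b and b. Then (T_k - t) f has
    Y_k-eigenvalue b and is negated by T_k, so it vanishes. *)
Lemma DL_nsMac n (a : 'X_{1..n}) k (hk : (k.+1 < n)%N) :
  a (olo hk) = a (ohi hk) -> DL k (nsMac a) = tt *: nsMac a.
Proof.
move=> ea; rewrite /nsMac /the_or.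
case: excluded_middle_informative => [ex|_]; last by rewrite DL0 // scaler0.
case: constructive_indefinite_description => f /= [_ Yf].
have Y1 := Yf (olo hk); have Y2 := Yf (ohi hk).
rewrite /= (kexp_eq ea) in Y1; rewrite /= -ea (YopS _ hk) in Y2.
set b := (_ * _) in Y2.
have {}Y1 : Yop k f = (tt * b) *: f by rewrite Y1 exprS mulrCA.
have k_lt := ltnW hk.
(* Apply T_k to Y_(k+1) f = b f, with Y_(k+1) expanded by [YopS]. *)
have Y3 : tt *: Yop k (DLinv k f) = b *: DL k f.
  have := congr1 (@DL n k) Y2.
  by rewrite (DLZ hk tt) (DLZ hk b) (DLK_inv hk).
have Y4 : Yop k (DL k f - tt *: f) = b *: (DL k f - tt *: f).
  rewrite (YopBZ tt (DL k f) f k_lt) Y1; apply: (eigen_comb tt_neq0).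
  rewrite -Y3; congr (_ *: _).
  by rewrite -Y1 -(YopBZ _ _ _ k_lt) -(YopZ _ _ k_lt) -(DLinvE hk).
apply/eqP; rewrite -subr_eq0; apply/eqP.
apply: (antisymmetric_eigen_eq0 hk _ Y4).
rewrite -scaleNr (DLD hk) (DLZ hk) (DL_quad hk).
by rewrite !scaleNr quadratic_comb.
Qed.

(** Since s_i fixes a, only the pair (i, i+1) matters; it is counted for s and no longer after the
    swap. *)
Lemma twinv_stp n (a : 'X_{1..n}) (s : 'S_n) i (hi : (i.+1 < n)%N) :
    a (olo hi) = a (ohi hi) -> (s (olo hi) < s (ohi hi))%N ->
  twinv a s = (twinv a (stp n i * s)%g).+1.
Proof.
move=> ea asc.
have := npairs_stp (fun j m => (a m <= a j)%N && (s j < s m)%N) hi.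
rewrite ea leqnn asc ltnNge (ltnW asc) addn0 addn1.
rewrite -[npairs (fun j m => _ && (s j < s m)%N)]/(twinv a s) => <-.
congr _.+1; apply: eq_card => -[j m]; rewrite !inE /= !permM.
have a_stp o : a (stp n i o) = a o.
  by rewrite stpE; case: tpermP => [->|->|].
by rewrite !a_stp.
Qed.

(** Conjugation by w_0 exchanges s_i and s_k, where i + k = n - 2 for 0-based indices. *)
Lemma revp_stp n (s : 'S_n) i k : (i + k).+2 = n ->
  revp (stp n i * s)%g = (stp n k * revp s)%g.
Proof.
move=> e; rewrite /revp /pmul !mulgA; congr (_ * _)%g.
have hi : (i.+1 < n)%N by lia.
have hk : (k.+1 < n)%N by lia.
apply/permP => o; rewrite !permM; apply: val_inj.
rewrite (stp_val _ hi) !permE /= -[nat_of_ord (stp n k o)]/(val _).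
rewrite (stp_val _ hk) /=.
have := ltn_ord o; move: (nat_of_ord o) => u.
by do ![case: ifP]; lia.
Qed.

(** Reversal turns the ascent of s at i into a descent at the mirror position k. Hence T_rev(s) =
    T_rev(s s_i) T_k, and the t produced by T_k offsets the extra pair in [twinv]. *)
Lemma nsMacPB_ascent n (a : 'X_{1..n}) (s : 'S_n) i (hi : (i.+1 < n)%N) :
    a (olo hi) = a (ohi hi) -> (s (olo hi) < s (ohi hi))%N ->
  nsMacPB a s = nsMacPB a (stp n i * s)%g.
Proof.
move=> ea asc; pose k := (n - i.+2)%N.
have e : (i + k).+2 = n by rewrite /k; lia.
have hk : (k.+1 < n)%N by lia.
have rlo : rev_ord (olo hk) = ohi hi by apply: val_inj => /=; lia.
have rhi : rev_ord (ohi hk) = olo hi by apply: val_inj => /=; lia.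
have eT : DL k (nsMac (revc a)) = tt *: nsMac (revc a).
  by apply: (@DL_nsMac _ _ _ hk); rewrite !mnmE rlo rhi.
have d : (revp s (ohi hk) < revp s (olo hk))%N.
  by rewrite /revp /pmul !permM !permE rlo rhi.
rewrite /nsMacPB (twinv_stp ea asc) (revp_stp _ e).
rewrite (DLperm_descent _ d) eT (DLpermZ _ tt) exprSr invfM -scalerA.
by rewrite [tt^-1 *: _]scalerA mulVf ?tt_neq0 // scale1r.
Qed.

(* i is 0-based: the paper's i is i+1 here; hypothesis alpha_i = alpha_{i+1}. *)
Theorem theorem1p2 (n : nat) (a : 'X_{1..n}) (i : nat) (hi : (i.+1 < n)%N)
    (s : 'S_n) :
  nth 0%N (a : seq nat) i = nth 0%N (a : seq nat) i.+1 ->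
  nsMacPB a s = nsMacPB a (pmul s (stp n i)).
Proof.
move=> ea; have {}ea : a (olo hi) = a (ohi hi) by rewrite !(mnm_nth 0%N).
rewrite /pmul; case: (boolP (s (ohi hi) < s (olo hi))%N) => [d|]; last first.
  by rewrite -ascentE; apply: nsMacPB_ascent.
(* At a descent of s, the permutation s s_i has an ascent, and applying s_i to it again gives back
   s. *)
have asc : ((stp n i * s)%g (olo hi) < (stp n i * s)%g (ohi hi))%N.
  by rewrite !permM stp_lo stp_hi.
by rewrite (nsMacPB_ascent ea asc) mulgA stp2 // mul1g.
Qed.
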